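(* Let $n\ge1$ be an integer, let $f:\mathbb{R}\to\mathbb{R}$ be a function, and let $x_1,\ldots,x_{n+1}$ be pairwise distinct real numbers. For $m\ge1$ and pairwise distinct reals $y_1,\ldots,y_m$ put $$\Delta^{m}_f(y_1,\ldots,y_m):=\sum_{i=1}^{m}\frac{f(y_i)}{\prod_{1\le j\le m,\,j\ne i}(y_i-y_j)} .$$ Then $$\Delta^{n+1}_f(x_1,\ldots,x_{n+1})=\frac{\Delta^{n}_f(x_2,\ldots,x_{n+1})-\Delta^{n}_f(x_1,\ldots,x_{n})}{x_{n+1}-x_1}.$$
   Context: Empty products equal $1$, so $\Delta^1_f(y_1)=f(y_1)$. *)

(* Defs.v *)
From mathcomp Require Import all_boot all_order all_algebra.
From mathcomp Require Import reals.

Set Implicit Arguments.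
Unset Strict Implicit.
Unset Printing Implicit Defensive.

Import GRing.Theory.
Local Open Scope ring_scope.

(* The points y_1, ..., y_m are indexed from 0.  The value is meaningful only
   for pairwise distinct points (injective y), as division by zero gives 0. *)
Definition divided_difference (R : realType) (f : R -> R) (m : nat)
    (y : 'I_m -> R) : R :=
  \sum_(i < m) f (y i) / \prod_(j < m | j != i) (y i - y j).

(* Main.v *)
(* Dropping the k-th point from the divided difference multiplies the i-th
   summand by [x i - x k], which also kills the k-th summand.  Subtracting the
   cases of the first and the last point leaves the constant factor
   [x ord_max - x ord0] in every summand. *)
Require Import Defs.
From mathcomp Require Import all_boot all_order all_algebra.
From mathcomp Require Import reals.

Import GRing.Theory.
Local Open Scope ring_scope.

Lemma divided_difference_lift (R : realType) (n : nat) (f : R -> R)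
    (x : 'I_n.+1 -> R) (k : 'I_n.+1) : injective x ->
  divided_difference f (fun i => x (lift k i)) =
    \sum_(i < n.+1) f (x i) / \prod_(j < n.+1 | j != i) (x i - x j)
                    * (x i - x k).
Proof.
move=> x_inj; rewrite (bigD1_ord k) //= subrr mulr0 add0r.
(* The full product at [lift k i] has one extra factor, [x (lift k i) - x k], from [j = k]; it is
   nonzero by injectivity and cancels the multiplier. *)
apply: eq_bigr => i _; rewrite [in RHS](bigD1_ord k) ?neq_lift //=.
rewrite (eq_bigl _ _ (fun j => congr1 negb (inj_eq (@lift_inj _ k) j i))).
have nz : x (lift k i) - x k != 0 by rewrite subr_eq0 inj_eq // eq_sym neq_lift.
by rewrite invfM [_^-1 / _]mulrC mulrA mulfVK.
Qed.

Theorem lemma2 (R : realType) (n : nat) (f : R -> R) (x : 'I_n.+1 -> R)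
  (hn : (1 <= n)%N) (hx : injective x) :
  divided_difference f x =
    (divided_difference f (fun i : 'I_n => x (lift ord0 i))
     - divided_difference f (fun i : 'I_n => x (widen_ord (leqnSn n) i)))
    / (x ord_max - x ord0).
Proof.
(* Widening an index amounts to skipping [ord_max], so [divided_difference_lift] covers both
   differences. *)
have -> : divided_difference f (fun i => x (widen_ord (leqnSn n) i)) =
          divided_difference f (fun i => x (lift ord_max i)).
  have widenE i : widen_ord (leqnSn n) i = lift ord_max i.
    by apply: val_inj; rewrite /= /bump leqNgt ltn_ord.
  apply: eq_bigr => i _; rewrite widenE; congr (_ / _).
  by apply: eq_bigr => j _; rewrite widenE.
rewrite !divided_difference_lift // -sumrB mulr_suml.
(* Here [hn] matters: [ord0] and [ord_max] coincide when [n = 0]. *)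
have nz : x ord_max - x ord0 != 0.
  by rewrite subr_eq0 inj_eq // -val_eqE /= -lt0n.
apply: eq_bigr => i _.
by rewrite -mulrBr opprB addrC addrA subrK mulfK.
Qed.
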